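(* Let $q$ be a prime power, $2\le n\le m$ integers, $\mathcal{C}\le\mathbb{F}_q^{n\times m}$ an $\mathbb{F}_q$-linear subspace of dimension $k$, and $0\le i\le k$. For all $0\le\tau\le m-1$, $$W_\mathcal{C}^{(i)}(X,Y)=\sum_{j=0}^{n-d_i}\beta_{\tau,j}^{(i)}(\mathcal{C})\,M_{\tau,d_i+j}^{(i)}(X,Y),$$ where $$\beta_{\tau,u}^{(i)}(\mathcal{C}):=\sum_{j=0}^u\frac{p_j^{(i)}(\mathcal{C})}{\left(p_{\tau,0}^{(i)}\right)^{u-j+1}}\,\mathcal{P}_{u-j}\left(p_{\tau,0}^{(i)},-p_{\tau,1}^{(i)},-p_{\tau,2}^{(i)},\ldots,-p_{\tau,u-j}^{(i)}\right).$$
   Context: The dual is $\mathcal{C}^\perp=\{N\in\mathbb{F}_q^{n\times m}:\operatorname{Tr}(MN^t)=0\ \forall M\in\mathcal{C}\}$; $d^\perp$ is the minimum rank of a nonzero element of $\mathcal{C}^\perp$, and $d^\perp=n+1$ if $\mathcal{C}^\perp=\{0\}$. An optimal anticode is a subspace $A\le\mathbb{F}_q^{n\times m}$ with $\dim A=m\cdot\max\{\operatorname{rk}(M):M\in A\}$, and $d_i=\frac1m\min\{\dim A: A\text{ an optimal anticode},\ \dim(A\cap\mathcal{C})\ge i\}$. For integers $a,b$ and a prime power $Q$, $\begin{bmatrix} a \\ b \end{bmatrix}_Q$ is $0$ if $b<0$ or $0\le a<b$; $1$ if $b=0$; $\prod_{s=1}^b\frac{Q^{a-s+1}-1}{Q^s-1}$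 if $b>0$, $a\ge b$; $(-1)^bQ^{ab-\binom b2}\begin{bmatrix} -a+b-1 \\ b \end{bmatrix}_Q$ if $b>0$, $a<0$. Weight enumerator: for $W\le\mathbb{F}_q^n$ let $A_W^{(i)}(\mathcal{C},c)$ (respectively, for $n=m$, $A_W^{(i)}(\mathcal{C},r)$) be the number of $i$-dimensional subspaces $\mathcal{D}\le\mathcal{C}$ such that the sum of the column spaces (respectively row spaces) of the elements of $\mathcal{D}$ equals $W$. For $0\le w\le n$, $A_w^{(i)}(\mathcal{C})=\sum_{\dim W=w}A_W^{(i)}(\mathcal{C},c)$ if $n<m$ and $A_w^{(i)}(\mathcal{C})=\frac12\sum_{\dim W=w}(A_W^{(i)}(\mathcal{C},c)+A_W^{(i)}(\mathcal{C},r))$ if $n=m$. Then $W_\mathcal{C}^{(i)}(X,Y)=\sum_{w=0}^nA_w^{(i)}(\mathcal{C})X^{n-w}Y^w$. Binomial moments: for $U\le\mathbb{F}_q^n$ let $\mathcal{C}(U)$ (respectively, if $n=m$, $\mathcal{C}[U]$) be the set of $M\in\mathcal{C}$ with column space (respectively row space) contained in $U$. For $0\le u\le n$, $B_u^{(i)}(\mathcal{C})=\sum_{\dim U=u}\begin{bmatrix} \dim\mathcal{C}(U) \\ i \end{bmatrix}_q$ if $n<m$, and $B_u^{(i)}(\mathcal{C})=\frac12\sum_{\dim U=u}\Big(\begin{bmatrix} \dim\mathcal{C}(U) \\ i \end{bmatrix}_q+\begin{bmatrix} \dim\mathcal{C}[U] \\ i \end{bmatrix}_q\Big)$ if $n=m$.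 For integers $u$: $b_u^{(i)}(\mathcal{C})=0$ if $u<0$; $b_u^{(i)}(\mathcal{C})=B_{u+d_i}^{(i)}(\mathcal{C})\big/\begin{bmatrix} n \\ u+d_i \end{bmatrix}_q$ if $0\le u\le n-d^\perp-d_i$; $b_u^{(i)}(\mathcal{C})=\begin{bmatrix} k-m(n-u-d_i) \\ i \end{bmatrix}_q$ if $u\ge0$ and $u>n-d^\perp-d_i$. For $u\ge0$, $p_u^{(i)}(\mathcal{C})=\sum_{j=0}^{i+1}\begin{bmatrix} i+1 \\ j \end{bmatrix}_{q^m}(-1)^jq^{m\binom j2}b_{u-j}^{(i)}(\mathcal{C})$. For $0\le\tau\le m-1$: $b_{\tau,u}^{(i)}=\begin{bmatrix} \tau+m\left(u-\lfloor\frac{\tau-i}{m}\rfloor\right) \\ i \end{bmatrix}_q$ for $u\ge0$ and $b_{\tau,u}^{(i)}=0$ for $u<0$; $p_{\tau,u}^{(i)}=\sum_{t=0}^{i+1}\begin{bmatrix} i+1 \\ t \end{bmatrix}_{q^m}(-1)^tq^{m\binom t2}b_{\tau,u-t}^{(i)}$ for $u\ge0$. $q$-Bernstein polynomials: $\mathcal{B}_{n,u}(X,Y;q)=\begin{bmatrix} n \\ u \end{bmatrix}_qY^u\prod_{j=0}^{n-u-1}(X-q^jY)$. For $0\le r\le n$, $M_{\tau,r}^{(i)}(X,Y)=\sum_{u=0}^{n-r}b_{\tau,u}^{(i)}\,\mathcal{B}_{n,u+r}(X,Y;q)$. Homogeneous ordinary Bell polynomials: for $0\le b\le a$, $\mathcal{P}_{a,b}(x_0,x_1,\dots,x_{a-b+1})$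 is the coefficient of $X^a$ in $\left(\sum_{j\ge1}x_jx_0^{j-1}X^j\right)^b$ (so $\mathcal{P}_{0,0}=1$, $\mathcal{P}_{a,0}=0$ for $a\ge1$), and $\mathcal{P}_a(x_0,x_1,\dots,x_a)=\sum_{b=0}^a\mathcal{P}_{a,b}(x_0,\dots,x_{a-b+1})$. *)

(* Defs.v *)
From HB Require Import structures.
From mathcomp Require Import all_boot all_order all_algebra.
From mathcomp Require Import mpoly.

Set Implicit Arguments.
Unset Strict Implicit.
Unset Printing Implicit Defensive.

Import Order.TTheory GRing.Theory Num.Theory.
Local Open Scope ring_scope.

(* The subspaces of a vector space over a finite field form a finite type. *)
Section VspaceFinite.
Import VectorInternalTheory.
Variables (F : finFieldType) (vT : vectType F).

HB.instance Definition _ := [Countable of {vspace vT} by <:].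
HB.instance Definition _ := [Finite of {vspace vT} by <:].

End VspaceFinite.

Lemma mem_span_closed (F : finFieldType) n m (S : {set 'M[F]_(n, m)}) M :
  submod_closed S -> (M \in <<enum S>>%VS) = (M \in S).
Proof.
case=> S0 SD; apply/idP/idP=> [|SM]; last by rewrite memv_span ?mem_enum.
rewrite -[enum _]/(tval (in_tuple (enum S))) => /coord_span->.
elim/big_ind: _ => [//|x y Sx Sy|k _]; first by rewrite -[x]scale1r SD.
by rewrite -[_ *: _]addr0 SD // -mem_enum mem_nth.
Qed.

(** Gaussian binomial coefficients with integer arguments *)

Definition qprod (Q : nat) (a : int) (b : nat) : rat :=
  \prod_(1 <= s < b.+1) ((Q%:R ^ (a - s%:Z + 1) - 1) / (Q%:R ^+ s - 1)).

Definition gbinom (Q : nat) (a b : int) : rat :=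
  if (b < 0) || (0 <= a < b) then 0
  else if b == 0 then 1
  else if b <= a then qprod Q a `|b|
  else (* here [a < 0 < b], so [0 < b <= - a + b - 1] *)
    (-1) ^+ `|b| * Q%:R ^ (a * b - 'C(`|b|, 2)%:Z)
      * qprod Q (- a + b - 1) `|b|.

Section Code.
Variables (F : finFieldType) (n m : nat).
Local Notation q := #|F|.
Implicit Types (M N : 'M[F]_(n, m)) (A C D : {vspace 'M[F]_(n, m)}).

Definition dual C : {set 'M[F]_(n, m)} :=
  [set N | [forall M in C, \tr (M *m N^T) == 0]].

(* Ranks are at most [n], so the default value [n.+1] is only reached when
   the dual is zero. *)
Definition ddual C : nat := \big[minn/n.+1]_(N in dual C | N != 0) \rank N.

Definition optimal_anticode A : bool :=
  \dim A == (m * \max_(M in A) \rank M)%N.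

(* The division is exact.  For [n <= m] and [i <= \dim C] the full matrix
   space is admissible and has dimension [n * m], so that the default value
   does not affect the minimum. *)
Definition gweight C (i : nat) : nat :=
  ((\big[minn/n * m]_(A : {vspace 'M[F]_(n, m)}
       | optimal_anticode A && (i <= \dim (A :&: C)%VS)) \dim A) %/ m)%N.

(* Vectors of [F^n] and [F^m] are written as rows. *)
Definition colspace M : {vspace 'rV[F]_n} := <<[seq (col j M)^T | j : 'I_m]>>%VS.
Definition rowspace M : {vspace 'rV[F]_m} := <<[seq row i M | i : 'I_n]>>%VS.

Definition wtc C (i : nat) (W : {vspace 'rV[F]_n}) : nat :=
  #|[set D : {vspace 'M[F]_(n, m)} |
      [&& (D <= C)%VS, \dim D == i & (\sum_(M in D) colspace M)%VS == W]]|.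
Definition wtr C (i : nat) (W : {vspace 'rV[F]_m}) : nat :=
  #|[set D : {vspace 'M[F]_(n, m)} |
      [&& (D <= C)%VS, \dim D == i & (\sum_(M in D) rowspace M)%VS == W]]|.

(* Row spaces only enter when [n = m]; this equality being propositional,
   the subspaces of [F^n] and of [F^m] are summed over separately.  The same
   applies to [binmoment]. *)
Definition wtdistr C (i w : nat) : rat :=
  if (n < m)%N then \sum_(W : {vspace 'rV[F]_n} | \dim W == w) (wtc C i W)%:R
  else 2^-1 * (\sum_(W : {vspace 'rV[F]_n} | \dim W == w) (wtc C i W)%:R
             + \sum_(W : {vspace 'rV[F]_m} | \dim W == w) (wtr C i W)%:R).

Definition wtenum C (i : nat) : {mpoly rat[2]} :=
  \sum_(w < n.+1) wtdistr C i w *: ('X_0 ^+ (n - w) * 'X_1 ^+ w).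

(* [C(U)] and [C[U]], as spans of their sets of elements; these sets are
   already subspaces, see [mem_shortc] and [mem_shortr]. *)
Definition shortc C (U : {vspace 'rV[F]_n}) : {vspace 'M[F]_(n, m)} :=
  <<enum [set M in C | (colspace M <= U)%VS]>>%VS.
Definition shortr C (U : {vspace 'rV[F]_m}) : {vspace 'M[F]_(n, m)} :=
  <<enum [set M in C | (rowspace M <= U)%VS]>>%VS.

Lemma mem_shortc C U M :
  (M \in shortc C U) = (M \in C) && (colspace M <= U)%VS.
Proof.
have sub N : (colspace N <= U)%VS = [forall j, (col j N)^T \in U].
  apply/span_subvP/forallP => [h j | h _ /imageP[j _ ->]]; last exact: h.
  by apply: h; apply: image_f.
rewrite mem_span_closed ?inE //; split=> [|a x y]; rewrite !inE !sub.
  by rewrite mem0v; apply/forallP => j; rewrite !linear0 mem0v.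
case/andP=> Cx /forallP Ux /andP[Cy /forallP Uy].
rewrite memvD ?memvZ //=; apply/forallP => j.
by rewrite !linearP memvD ?memvZ ?Ux ?Uy.
Qed.

Lemma mem_shortr C U M :
  (M \in shortr C U) = (M \in C) && (rowspace M <= U)%VS.
Proof.
have sub N : (rowspace N <= U)%VS = [forall j, row j N \in U].
  apply/span_subvP/forallP => [h j | h _ /imageP[j _ ->]]; last exact: h.
  by apply: h; apply: image_f.
rewrite mem_span_closed ?inE //; split=> [|a x y]; rewrite !inE !sub.
  by rewrite mem0v; apply/forallP => j; rewrite !linear0 mem0v.
case/andP=> Cx /forallP Ux /andP[Cy /forallP Uy].
rewrite memvD ?memvZ //=; apply/forallP => j.
by rewrite !linearP memvD ?memvZ ?Ux ?Uy.
Qed.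

Definition binmoment C (i u : nat) : rat :=
  if (n < m)%N then
    \sum_(U : {vspace 'rV[F]_n} | \dim U == u) gbinom q (\dim (shortc C U)) i
  else
    2^-1 * (\sum_(U : {vspace 'rV[F]_n} | \dim U == u)
              gbinom q (\dim (shortc C U)) i
          + \sum_(U : {vspace 'rV[F]_m} | \dim U == u)
              gbinom q (\dim (shortr C U)) i).

Definition nbinmoment C (i : nat) (u : int) : rat :=
  let d := gweight C i in
  if u < 0 then 0
  else if u <= n%:Z - (ddual C)%:Z - d%:Z then
    binmoment C i (`|u| + d)%N / gbinom q n (u + d%:Z)
  else gbinom q ((\dim C)%:Z - m%:Z * (n%:Z - u - d%:Z)) i.

Definition zcoef C (i u : nat) : rat :=
  \sum_(j < i.+2) gbinom (q ^ m) i.+1 j * (-1) ^+ j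
     * (q ^ (m * 'C(j, 2)))%:R * nbinmoment C i (u%:Z - j%:Z).

End Code.

Section CodeFree.
Variables (q n m i tau : nat).

(* [%/] is floor division when [0 < m]. *)
Definition nbinmoment_tau (u : int) : rat :=
  if u < 0 then 0
  else gbinom q (tau%:Z + m%:Z * (u - ((tau%:Z - i%:Z) %/ m%:Z)%Z)) i.

Definition zcoef_tau (u : nat) : rat :=
  \sum_(t < i.+2) gbinom (q ^ m) i.+1 t * (-1) ^+ t
     * (q ^ (m * 'C(t, 2)))%:R * nbinmoment_tau (u%:Z - t%:Z).

Definition qbernstein (u : nat) : {mpoly rat[2]} :=
  gbinom q n u *:
    ('X_1 ^+ u * \prod_(j < n - u) ('X_0 - (q ^ j)%:R *: 'X_1)).

Definition mrdenum (r : nat) : {mpoly rat[2]} :=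
  \sum_(u < (n - r).+1) nbinmoment_tau u%:Z *: qbernstein (u + r).

End CodeFree.

(** Homogeneous ordinary Bell polynomials, evaluated at [x 0, x 1, ...] *)

(* The power series is truncated after degree [a], which does not affect
   the coefficient of [X^a]. *)
Definition bellp (a b : nat) (x : nat -> rat) : rat :=
  ((\sum_(1 <= j < a.+1) (x j * x 0%N ^+ (j - 1)) *: 'X^j) ^+ b)`_a.

Definition bell (a : nat) (x : nat -> rat) : rat :=
  \sum_(b < a.+1) bellp a b x.

Definition beta (F : finFieldType) (n m : nat) (C : {vspace 'M[F]_(n, m)})
    (i tau u : nat) : rat :=
  let pt := zcoef_tau #|F| m i tau in
  \sum_(j < u.+1) zcoef C i j / pt 0%N ^+ (u - j + 1)
     * bell (u - j) (fun l => if l == 0%N then pt 0%N else - pt l).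

(* Main.v *)
(* Counting subspaces by their support and the q-binomial theorem give
   [W = sum_u B_u Y^u prod_j (X - q^j Y)].  The matrices supported in a given
   U form an optimal anticode of dimension [m * dim U], so [B_u] vanishes for
   [u < d_i]; hence W has coefficients [b_v] in the Bernstein polynomials of
   index [v + d_i].  In the same basis the right-hand side has as coefficients
   the convolution of beta and [b_tau].  If G denotes the generating polynomial
   of the Gaussian weights defining p, then [p = G b] and
   [p_tau = G b_tau], while the Bell polynomials are the coefficients of the
   geometric series for [1 / p_tau]: thus [beta = p / p_tau = b / b_tau]. *)

Require Import Defs.
From HB Require Import structures.
From mathcomp Require Import all_boot all_order all_algebra all_field.
From mathcomp Require Import mpoly zify ring.
Import Order.TTheory GRing.Theory Num.Theory.
Local Open Scope ring_scope.

(** * Gaussian binomials and the q-binomial theorem *)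

Lemma gbinom0r Q (a : int) : gbinom Q a 0 = 1.
Proof. by rewrite /gbinom eqxx ltxx /= lt_def; case: ltrgt0P. Qed.

Lemma gbinom_small Q (a b : nat) : (a < b)%N -> gbinom Q a b = 0.
Proof. by move=> lt_ab; rewrite /gbinom ltz_nat lt_ab orbT. Qed.

Lemma gbinom_prod Q (a b : nat) : (b <= a)%N ->
  gbinom Q a b =
  \prod_(s < b) ((Q%:R ^+ (a - s) - 1) / (Q%:R ^+ s.+1 - 1)).
Proof.
move=> le_ba; rewrite /gbinom ltz_nat ltnNge le_ba /= lez_nat le_ba.
case: b le_ba => [|b] le_ba /=; first by rewrite big_ord0.
rewrite /qprod big_add1 /= big_mkord; apply: eq_bigr => s _.
have -> : (a%:Z - s.+1%:Z + 1 = (a - s)%N%:Z)%R by have := ltn_ord s; lia.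
by [].
Qed.

Section GaussianBinomial.
Variables (Q : nat) (Q_gt1 : (1 < Q)%N).

Lemma expQ_neq1 (k : nat) : (0 < k)%N -> Q%:R ^+ k - 1 != 0 :> rat.
Proof.
by move=> k0; rewrite subr_eq0 gt_eqF // exprn_egt1 ?ltr1n // -lt0n.
Qed.

Lemma gbinom_neq0 (a b : nat) : (b <= a)%N -> gbinom Q a b != 0.
Proof.
move=> le_ba; rewrite gbinom_prod //; apply/prodf_neq0 => s _.
by rewrite mulf_neq0 ?invr_neq0 ?expQ_neq1 // subn_gt0; have := ltn_ord s; lia.
Qed.

Lemma gbinomSS (a b : nat) :
  gbinom Q a.+1 b.+1 * (Q%:R ^+ b.+1 - 1) = (Q%:R ^+ a.+1 - 1) * gbinom Q a b.
Proof.
have [lt_ab|le_ba] := ltnP a b; first by rewrite !gbinom_small ?mul0r ?mulr0.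
rewrite !gbinom_prod // !prodf_div big_ord_recl subn0.
by rewrite [X in _ / X * _]big_ord_recr /= invfM !mulrA divfK ?expQ_neq1 //.
Qed.

Lemma gbinom_lower (a b : nat) : (b <= a)%N ->
  gbinom Q a.+1 b * (Q%:R ^+ (a.+1 - b) - 1) = (Q%:R ^+ a.+1 - 1) * gbinom Q a b.
Proof.
elim: b a => [|b IH] [|a] // le_ba; rewrite ?gbinom0r ?mul1r ?mulr1 //.
apply: (mulIf (expQ_neq1 b.+1 isT)).
by rewrite subSS mulrAC gbinomSS -!mulrA IH // gbinomSS.
Qed.

Lemma gbinom_pascal (a b : nat) : (b <= a)%N ->
  gbinom Q a.+1 b.+1 = gbinom Q a b.+1 + Q%:R ^+ (a - b) * gbinom Q a b.
Proof.
case: a => [|a] le_ba.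
  move: le_ba; rewrite leqn0 => /eqP->.
  rewrite (@gbinom_small Q 0 1) // gbinom0r add0r mulr1 gbinom_prod //.
  by rewrite !big_ord_recl !big_ord0 subn0 mulr1 divff // expQ_neq1.
apply: (mulIf (expQ_neq1 b.+1 isT)).
rewrite mulrDl !gbinomSS.
have [lt_ab|{}le_ba] := ltnP a b.
  have -> : b = a.+1 by lia.
  by rewrite (@gbinom_small Q a a.+1) // mulr0 add0r subnn mul1r mulrC.
(* All terms become multiples of [gbinom Q a.+1 b], which leaves an identity between powers of
   [Q]. *)
rewrite -[in RHS]gbinom_lower //.
have -> : Q%:R ^+ a.+2 = Q%:R ^+ (a.+1 - b) * Q%:R ^+ b.+1 :> rat.
  by rewrite -exprD; congr (_ ^+ _); lia.
ring.
Qed.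

(** Induction on [N]: splitting X as (X - Q^(N-u) Y) + Q^(N-u) Y sends X times the u-th product to
    the products of index u and u+1 for N+1, and [gbinom_pascal] collects them. The morphism [f]
    moves rational coefficients into the ring of X and Y. *)
Lemma qbinomial_theorem (A : comNzRingType) (f : {rmorphism rat -> A})
    (X Y : A) (N : nat) :
  \sum_(u < N.+1) f (gbinom Q N u) *
     (Y ^+ u * \prod_(j < N - u) (X - (Q ^ j)%:R * Y)) = X ^+ N.
Proof.
pose T N u := Y ^+ u * \prod_(j < N - u) (X - (Q ^ j)%:R * Y).
rewrite -[LHS]/(\sum_(u < N.+1) f (gbinom Q N u) * T N u).
elim: N => [|N IH].
  by rewrite big_ord_recl big_ord0 /T big_ord0 gbinom0r rmorph1 !mul1r addr0.
rewrite big_ord_recl gbinom0r rmorph1 mul1r exprS -IH mulr_sumr /=.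
have step u : (u <= N)%N -> T N.+1 u = (X - (Q ^ (N - u))%:R * Y) * T N u.
  by move=> uN; rewrite /T subSn // big_ord_recr /=; ring.
have stepS u : T N.+1 u.+1 = Y * T N u by rewrite /T subSS exprS mulrA.
rewrite [RHS](_ : _ = \sum_(u < N.+1) f (gbinom Q N u) * T N.+1 u
    + \sum_(u < N.+1) f (Q%:R ^+ (N - u) * gbinom Q N u) * T N.+1 u.+1); last first.
  rewrite -big_split; apply: eq_bigr => u _ /=.
  rewrite stepS step -1?ltnS // -natrX rmorphM rmorph_nat.
  by move: (f _) (T N u) => g t; ring.
rewrite [X in _ = X + _]big_ord_recl gbinom0r rmorph1 mul1r -addrA; congr (_ + _).
have -> : \sum_(i < N) f (gbinom Q N (bump 0 i)) * T N.+1 (bump 0 i)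
  = \sum_(i < N.+1) f (gbinom Q N i.+1) * T N.+1 i.+1.
  by rewrite big_ord_recr /= (gbinom_small _ _ _ (ltnSn _)) rmorph0 mul0r addr0.
rewrite -big_split; apply: eq_bigr => u _ /=.
by rewrite /bump add1n gbinom_pascal -1?ltnS // rmorphD mulrDl.
Qed.

End GaussianBinomial.

(** * Convolution of sequences *)

Section Convolution.
Variable R : comNzRingType.
Implicit Types a b c : nat -> R.

Definition conv a b (v : nat) : R := \sum_(j < v.+1) a j * b (v - j)%N.

Lemma eq_conv a a' b b' v :
  (forall j, (j <= v)%N -> a j = a' j) -> (forall j, (j <= v)%N -> b j = b' j) ->
  conv a b v = conv a' b' v.
Proof.
by move=> ea eb; apply: eq_bigr => j _; rewrite ea -1?ltnS // eb ?leq_subr.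
Qed.

(** Truncation at any degree [N >= v] is harmless, so the ring laws of polynomials pass to
    [conv]. *)
Lemma conv_coef a b v N : (v <= N)%N ->
  conv a b v = ((\poly_(l < N.+1) a l) * \poly_(l < N.+1) b l)`_v.
Proof.
move=> vN; rewrite coefM; apply: eq_bigr => j _; rewrite !coef_poly.
have jv := ltn_ord j; rewrite ltnS in jv.
by rewrite !ltnS (leq_trans jv vN) (leq_trans (leq_subr _ _) vN).
Qed.

Lemma convC a b v : conv a b v = conv b a v.
Proof. by rewrite !(conv_coef _ _ _ _ (leqnn v)) mulrC. Qed.

Lemma convA a b c v : conv a (conv b c) v = conv (conv a b) c v.
Proof.
pose P a := \poly_(l < v.+1) a l : {poly R}.
transitivity ((P a * (P b * P c))`_v).
  rewrite coefM; apply: eq_bigr => j _; rewrite -conv_coef ?leq_subr //.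
  by rewrite coef_poly ltn_ord.
rewrite mulrA coefM; apply: eq_bigr => j _; rewrite -conv_coef -1?ltnS //.
by rewrite coef_poly ltnS leq_subr.
Qed.

Lemma conv1 a v : conv a (fun l => (l == 0%N)%:R) v = a v.
Proof.
rewrite /conv big_ord_recr /= subnn mulr1 big1 ?add0r // => j _.
by rewrite subn_eq0 leqNgt ltn_ord mulr0.
Qed.

(** Convolution with [g] is triangular with ones on the diagonal, so terms are recovered one by one.
    This stands in for division by a power series. *)
Lemma conv_inj g a b : g 0%N = 1 -> conv g a =1 conv g b -> a =1 b.
Proof.
move=> g0 eq_gab v; elim/ltn_ind: v => v IH; move: (eq_gab v).
rewrite /conv !big_ord_recl g0 !mul1r !subn0.
rewrite (eq_bigr (fun j : 'I_v => g (lift ord0 j) * b (v - lift ord0 j)%N)).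
  exact: addIr.
by move=> j _; rewrite IH //= /bump; have := ltn_ord j; lia.
Qed.

End Convolution.
Arguments conv {R} a b v.

Lemma triangular_sum (V : nmodType) (N : nat) (f : nat -> nat -> V) :
  \sum_(j < N.+1) \sum_(u < (N - j).+1) f j (u + j)%N
  = \sum_(v < N.+1) \sum_(j < v.+1) f j v.
Proof.
have -> : \sum_(v < N.+1) \sum_(j < v.+1) f j v =
   \sum_(v < N.+1) \sum_(j < N.+1 | (j <= v)%N) f j v.
  by apply: eq_bigr => v _; rewrite (big_ord_widen N.+1 (fun j => f j v)).
rewrite (exchange_big_dep xpredT) //=; apply: eq_bigr => j _.
rewrite -(big_mkord xpredT (fun u => f j (u + j)%N)).
rewrite -(big_mkord (fun v => (j <= v)%N) (fun v => f j v)).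
have jN : (j <= N.+1)%N by have := ltn_ord j; lia.
rewrite [RHS](big_cat_nat _ jN) //= [X in _ = X + _]big_nat_cond.
rewrite [X in _ = X + _]big1 ?add0r; last first.
  by move=> v; rewrite ltnNge; case: (j <= v)%N; rewrite ?andbF.
have -> F P : \sum_(j <= v < N.+1 | P v) F v
    = \sum_(0 <= u < (N - j).+1 | P (u + j)%N) F (u + j)%N :> V.
  by rewrite -{1}[j : nat]add0n big_addn subSn -1?ltnS.
by rewrite [RHS]big_mkcond; apply: eq_big_nat => u _; rewrite leq_addl.
Qed.

(** * Bell polynomials and the inverse of a power series *)

Lemma coef_exp_eq (R : comNzRingType) (p r : {poly R}) a b :
  (forall j, (j <= a)%N -> p`_j = r`_j) -> (p ^+ b)`_a = (r ^+ b)`_a.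
Proof.
elim: b a => [//|b IH] a e; rewrite !exprS !coefM; apply: eq_bigr => j _.
rewrite e -1?ltnS //; congr (_ * _); apply: IH => l le_l.
by apply: e; apply: leq_trans le_l (leq_subr _ _).
Qed.

Lemma coef_exp_gt (R : comNzRingType) (p : {poly R}) a b :
  p`_0 = 0 -> (a < b)%N -> (p ^+ b)`_a = 0.
Proof.
move=> p0 lt_ab; have -> : p = 'X * \poly_(l < size p) p`_l.+1.
  apply/polyP => -[|l]; rewrite coefXM //= coef_poly.
  by case: ltnP => // ?; rewrite nth_default // ltnW.
by rewrite exprMn coefXnM lt_ab.
Qed.

(** The product telescopes to 1 - h^(v+1), and h^(v+1) has no term of degree v. *)
Lemma coef_geometric (R : comNzRingType) (h : {poly R}) v : h`_0 = 0 ->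
  ((\sum_(b < v.+1) h ^+ b) * (1 - h))`_v = (v == 0%N)%:R.
Proof.
move=> h0; rewrite mulrC -opprB mulNr -subrX1 opprB coefB coef1.
by rewrite coef_exp_gt // subr0.
Qed.

Lemma coef_bell_series a (x : nat -> rat) l :
  (\sum_(1 <= j < a.+1) (x j * x 0%N ^+ (j - 1)) *: 'X^j)`_l
  = if (0 < l <= a)%N then x l * x 0%N ^+ (l - 1) else 0.
Proof.
pose h j := if j == 0%N then 0 else x j * x 0%N ^+ (j - 1).
have -> : \sum_(1 <= j < a.+1) (x j * x 0%N ^+ (j - 1)) *: 'X^j
    = \poly_(j < a.+1) h j.
  rewrite poly_def big_ord_recl /= scale0r add0r big_add1 big_mkord.
  by apply: eq_bigr.
by rewrite coef_poly ltnS /h; case: l.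
Qed.

(** One truncation order [v] serves all degrees [a <= v]: in degree [a], powers with exponent above
    [a] vanish and terms of the series beyond degree [a] are not seen. *)
Lemma bell_coef v a (x : nat -> rat) : (a <= v)%N ->
  bell a x = (\sum_(b < v.+1)
    (\sum_(1 <= j < v.+1) (x j * x 0%N ^+ (j - 1)) *: 'X^j) ^+ b)`_a.
Proof.
move=> le_av.
pose H k : {poly rat} := \sum_(1 <= j < k.+1) (x j * x 0%N ^+ (j - 1)) *: 'X^j.
rewrite coef_sum (bigID (fun b : 'I_v.+1 => (b < a.+1)%N)) /=.
rewrite [X in _ + X]big1 ?addr0 => [|b]; last first.
  by rewrite -leqNgt => lt_ab; rewrite coef_exp_gt ?coef_bell_series.
rewrite -(big_ord_widen _ (fun b => (H v ^+ b)`_a)) 1?ltnS //; apply: eq_bigr => b _.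
apply: coef_exp_eq => j le_ja; rewrite !coef_bell_series.
by rewrite le_ja (leq_trans le_ja).
Qed.

(** With x_0 = p_0 and x_j = -p_j the inner series satisfies 1 - h(X) = p(p_0 X) / p_0, so its
    geometric series gives the coefficients of 1/p up to powers of p_0. *)
Lemma conv_bell (p : nat -> rat) v : p 0%N != 0 ->
  conv (fun l => bell l (fun j => if j == 0%N then p 0%N else - p j)
                 / p 0%N ^+ (l + 1)) p v = (v == 0%N)%:R.
Proof.
move=> p0; pose x j := if j == 0%N then p 0%N else - p j.
pose h := \sum_(1 <= j < v.+1) (x j * x 0%N ^+ (j - 1)) *: 'X^j : {poly rat}.
have h0 : h`_0 = 0 by rewrite coef_bell_series.
(* Division by p_0^v undoes, in degree v, the substitution of p_0 X for X. *)
transitivity (((\sum_(b < v.+1) h ^+ b) * (1 - h))`_v / p 0%N ^+ v); last first.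
  by rewrite coef_geometric //; case: v {h h0} => [|v]; rewrite ?divr1 ?mul0r.
rewrite coefM mulr_suml; apply: eq_bigr => -[j /=]; rewrite ltnS => le_jv _.
rewrite -bell_coef // -!mulrA; congr (_ * _).
rewrite coefB coef1 coef_bell_series leq_subr andbT /x /=.
have [l def_v] : {l | v = (j + l)%N} by exists (v - j)%N; rewrite subnKC.
rewrite def_v addKn addn1 exprD exprS.
have [-> | l0] /= := posnP l; first by field; rewrite ?expf_neq0.
case: l l0 {def_v} => // l _; rewrite /= subn1 /= exprS.
by field; rewrite ?expf_neq0 ?p0.
Qed.

(** * Scalar form of the q-binomial theorem, and subspace counts *)

Lemma qbinomial_scale (Q : nat) (A : comAlgType rat) (X Y : A) (N : nat) :
  (1 < Q)%N ->
  \sum_(u < N.+1) gbinom Q N u *: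
     (Y ^+ u * \prod_(j < N - u) (X - (Q ^ j)%:R *: Y)) = X ^+ N.
Proof.
move=> Q1; rewrite -(qbinomial_theorem Q Q1 A (GRing.in_alg A) X Y).
apply: eq_bigr => u _ /=; rewrite mulr_algl; congr (_ *: (_ * _)).
by apply: eq_bigr => j _; rewrite scaler_nat mulr_natl.
Qed.

Lemma dim_fullv_matrix (F : fieldType) a b :
  \dim (fullv : {vspace 'M[F]_(a, b)}) = (a * b)%N.
Proof. exact: dimvf. Qed.

Lemma dim_fullv_row (F : fieldType) b : \dim (fullv : {vspace 'rV[F]_b}) = b.
Proof. by rewrite dim_fullv_matrix mul1n. Qed.

Lemma dim_row_le (F : fieldType) b (U : {vspace 'rV[F]_b}) : (\dim U <= b)%N.
Proof. by have := dimvS (subvf U); rewrite dim_fullv_row. Qed.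

Section SubspaceCount.
Variables (F : finFieldType) (a b : nat).
Local Notation q := #|F|.
Implicit Types U V W D : {vspace 'M[F]_(a, b)}.

Definition subspaces_between W V r : {set {vspace 'M[F]_(a, b)}} :=
  [set D | [&& (W <= D)%VS, (D <= V)%VS & \dim D == r]].

Lemma card_vspaceD W V : (W <= V)%VS ->
  #|[pred v | (v \in V) && (v \notin W)]|%:R
  = q%:R ^+ \dim V - q%:R ^+ \dim W :> rat.
Proof.
move=> sWV; rewrite -!natrX -!card_vspace -(cardID (mem W) (mem V)) natrD.
rewrite (@eq_card _ [predI V & W] W) => [|v]; last first.
  by rewrite !inE andb_idl // => Wv; apply: (subvP sWV).
by rewrite addrC addKr; congr (_%:R); apply: eq_card => v; rewrite !inE andbC.
Qed.

(* Double counting of the pairs [v \in D], [v \notin W]. *)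
Lemma card_subspaces_between_rec W V r : (W <= V)%VS ->
  #|subspaces_between W V r|%:R * (q%:R ^+ r - q%:R ^+ \dim W) =
  \sum_(v | (v \in V) && (v \notin W))
     #|subspaces_between (W + <[v]>) V r|%:R :> rat.
Proof.
move=> sWV.
transitivity (\sum_(D in subspaces_between W V r)
   \sum_(v | (v \in D) && (v \notin W)) (1 : rat)).
  rewrite mulr_natl -sumr_const; apply: eq_bigr => D.
  rewrite inE => /and3P[sWD sDV /eqP dimD].
  by rewrite -[in LHS]dimD -card_vspaceD // sumr_const.
rewrite (exchange_big_dep (fun v => (v \in V) && (v \notin W))) /=; last first.
  by move=> D v; rewrite inE => /and3P[_ /subvP sDV _] /andP[/sDV-> ->].
apply: eq_bigr => v /andP[Vv W'v]; rewrite sumr_const; congr (_%:R).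
apply: eq_card => D; rewrite [LHS]unfold_in !inE W'v andbT subv_add -memvE -!andbA.
by case: (v \in D); rewrite ?andbF ?andbT.
Qed.

(** Induction on [k]: adjoining a vector outside [W] raises its dimension by one, so all summands in
    [card_subspaces_between_rec] agree and the recursion is that of [gbinomSS]. *)
Lemma card_subspaces_between W V k : (W <= V)%VS ->
  #|subspaces_between W V (\dim W + k)%N|%:R = gbinom q (\dim V - \dim W)%N k :> rat.
Proof.
have q1 : (1 < q)%N := finNzRing_gt1 F.
elim: k W => [|k IH] W sWV.
  rewrite addn0 gbinom0r (_ : subspaces_between W V _ = [set W]) ?cards1 //.
  apply/setP => D; rewrite !inE; apply/and3P/eqP => [[sWD _ /eqP dimD] | ->].
    by apply/esym/eqP; rewrite eqEdim sWD dimD /=.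
  by rewrite subvv sWV eqxx.
have neq0 : q%:R ^+ (\dim W + k.+1) - q%:R ^+ \dim W != 0 :> rat.
  rewrite exprD -{2}[_ ^+ \dim W]mulr1 -mulrBr mulf_neq0 ?expQ_neq1 //.
  by rewrite expf_neq0 // pnatr_eq0 -lt0n ltnW.
apply: (mulIf neq0); rewrite card_subspaces_between_rec //.
rewrite (eq_bigr (fun=> gbinom q (\dim V - \dim W).-1 k)) => [|v /andP[Vv W'v]].
  rewrite sumr_const -[LHS]mulr_natl.
  rewrite [X in X * _](_ : _ = q%:R ^+ \dim V - q%:R ^+ \dim W);
    last exact: card_vspaceD.
  (* If [V = W] there is no vector to adjoin, and both sides are 0. *)
  have [eq_dim | lt_dim] := leqP (\dim V) (\dim W).
    have -> : V = W by apply/eqP; rewrite eq_sym eqEdim sWV.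
    by rewrite subrr subnn (gbinom_small _ 0 k.+1) // !mul0r.
  have [d def_d] : {d | \dim V = (\dim W + d.+1)%N}.
    by exists (\dim V - (\dim W).+1)%N; rewrite addnS -addSn subnKC.
  rewrite def_d addKn /= !exprD.
  have := gbinomSS q q1 d k; move: (gbinom _ _ _) (gbinom _ _ _) => x y e.
  by transitivity (q%:R ^+ \dim W * ((q%:R ^+ d.+1 - 1) * x)); [|rewrite -e]; ring.
have dimWv : \dim (W + <[v]>) = (\dim W).+1.
  rewrite dimv_disjoint_sum ?dim_vline; last first.
    apply/eqP; rewrite -subv0; apply/subvP => x; rewrite memv_cap.
    case/andP=> Wx /vlineP[c def_x]; rewrite memv0 def_x.
    have [->|c0] := eqVneq c 0; first by rewrite scale0r.
    by case/negP: W'v; have:= memvZ c^-1 Wx; rewrite def_x scalerA mulVf // scale1r.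
  by rewrite (_ : v != 0) ?addn1 //; apply: contraNneq W'v => ->; rewrite mem0v.
by rewrite addnS -addSn -dimWv IH ?dimWv ?subnS // subv_add sWV -memvE.
Qed.

End SubspaceCount.

(** * Weight enumerators by support *)

Section SupportEnumerator.
Variables (F : finFieldType) (n m N : nat).
Local Notation q := #|F|.
Variables (sp : 'M[F]_(n, m) -> {vspace 'rV[F]_N}) (C : {vspace 'M[F]_(n, m)}).
Variable short : {vspace 'rV[F]_N} -> {vspace 'M[F]_(n, m)}.
Hypothesis mem_short :
  forall U M, (M \in short U) = (M \in C) && (sp M <= U)%VS.

(** The left side counts the [i]-dimensional subspaces of [short U], here sorted by support: D lies
    in [short U] exactly when it lies in [C] and its support in [U]. *)
Lemma gbinom_short (i : nat) U :
  gbinom q (\dim (short U)) i = \sum_(W | (W <= U)%VS)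
    #|[set D : {vspace 'M[F]_(n, m)} |
      [&& (D <= C)%VS, \dim D == i & (\sum_(M in D) sp M)%VS == W]]|%:R.
Proof.
have := card_subspaces_between F n m 0%VS (short U) i (sub0v _).
rewrite dimv0 add0n subn0 => <-; rewrite -natr_sum; congr (_%:R).
rewrite -[LHS]sum1_card. rewrite [LHS](partition_big
  (fun D : {vspace 'M[F]_(n, m)} => (\sum_(M in D) sp M)%VS)
  (fun W : {vspace 'rV[F]_N} => (W <= U)%VS)) /= => [|D]; last first.
  rewrite inE sub0v /= => /andP[/subvP sDU _]; apply/subv_sumP => M /sDU.
  by rewrite mem_short => /andP[].
apply: eq_bigr => W sWU; rewrite -sum1_card; apply: eq_bigl => D.
rewrite !inE sub0v /=; apply/andP/and3P.
  case=> /andP[/subvP sD dimD] defW; split=> //.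
  by apply/subvP => M /sD; rewrite mem_short => /andP[].
case=> /subvP sD dimD /eqP defW; rewrite dimD defW; split=> //; rewrite andbT.
apply/subvP => M DM; rewrite mem_short sD //=; apply: subv_trans sWU.
by rewrite -defW; apply: (sumv_sup M).
Qed.

Lemma sum_by_dim (V : nmodType) (f : nat -> {vspace 'rV[F]_N} -> V) P :
  \sum_(u < N.+1) \sum_(U | P U && (\dim U == u)) f u U =
  \sum_(U | P U) f (\dim U) U.
Proof.
rewrite [RHS](partition_big (fun U => inord (\dim U) : 'I_N.+1) xpredT) //=.
apply: eq_bigr => u _; apply: eq_big => U.
  by rewrite -val_eqE /= inordK // ltnS dim_row_le.
by case/andP=> _ /eqP->.
Qed.

(** After sorting by support, each [W] contributes through all [U] containing it; the q-binomial
    theorem for the quotient by [W] contracts these contributions to one monomial. *)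
Lemma support_enumerator (A : comAlgType rat) (X Y : A) i :
  \sum_(w < N.+1) (\sum_(W : {vspace 'rV[F]_N} | \dim W == w)
    #|[set D : {vspace 'M[F]_(n, m)} |
      [&& (D <= C)%VS, \dim D == i & (\sum_(M in D) sp M)%VS == W]]|%:R : rat)
      *: (X ^+ (N - w) * Y ^+ w) =
  \sum_(u < N.+1) (\sum_(U : {vspace 'rV[F]_N} | \dim U == u)
                    gbinom q (\dim (short U)) i)
      *: (Y ^+ u * \prod_(j < N - u) (X - (q ^ j)%:R *: Y)).
Proof.
pose T u := Y ^+ u * \prod_(j < N - u) (X - (q ^ j)%:R *: Y).
transitivity (\sum_(U : {vspace 'rV[F]_N})
    gbinom q (\dim (short U)) i *: T (\dim U)); last first.
  rewrite -(sum_by_dim _ (fun u U => gbinom q (\dim (short U)) i *: T u)).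
  by apply: eq_bigr => u _; rewrite scaler_suml.
under eq_bigr do rewrite scaler_suml.
rewrite (sum_by_dim _ (fun w W => _ *: (X ^+ (N - w) * Y ^+ w)) xpredT).
under [RHS]eq_bigr do rewrite gbinom_short scaler_suml.
rewrite [RHS](exchange_big_dep xpredT) //=; apply: eq_bigr => W _.
rewrite -scaler_sumr; congr (_ *: _).
rewrite -(sum_by_dim _ (fun u U => T u)).
have dimWN := dim_row_le _ _ W.
have q1 : (1 < q)%N := finNzRing_gt1 F.
rewrite -(big_mkord xpredT (fun u =>
  \sum_(U : {vspace 'rV[F]_N} | (W <= U)%VS && (\dim U == u)) T u)).
(* No [U] of dimension below [\dim W] contains [W]; the remaining dimensions are written
   [\dim W + t]. *)
rewrite [RHS](big_cat_nat (leq0n _) (leqW dimWN)) /= big_nat.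
rewrite [X in _ = X + _]big1 ?add0r; last first.
  move=> u /andP[_ lt_uW]; apply: big1 => U /andP[/dimvS sWU /eqP dimU].
  by rewrite dimU leqNgt lt_uW in sWU.
rewrite -{3}[\dim W]add0n big_addn subSn // big_mkord.
rewrite -(qbinomial_scale q A X Y (N - \dim W) q1) mulr_suml.
apply: eq_bigr => t _.
rewrite sumr_const -scaler_nat addnC.
have := card_subspaces_between F 1 N W fullv t (subvf _).
rewrite dim_fullv_row => <-; rewrite -scalerAl; congr (_ *: _).
  by congr (_%:R); apply: eq_card => U; rewrite !inE subvf.
by rewrite /T exprD subnDA [LHS]mulrC mulrA.
Qed.

End SupportEnumerator.

(** * Row subspaces as matrices, and trace duality *)

Section VspaceBasisMatrix.
Variables (F : finFieldType) (n : nat).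
Implicit Types U : {vspace 'rV[F]_n}.

Definition basis_mx U : 'M[F]_(\dim U, n) := \matrix_(k < \dim U) (vbasis U)`_k.

Lemma mem_basis_mx U v : (v \in U) = (v <= basis_mx U)%MS.
Proof.
apply/idP/submxP => [/coord_vbasis-> | [x ->]].
  exists (\row_k coord (vbasis U) k v); rewrite mulmx_sum_row.
  by apply: eq_bigr => k _; rewrite mxE rowK.
rewrite mulmx_sum_row; apply: memv_suml => k _; rewrite rowK memvZ //.
by apply: vbasis_mem; rewrite mem_nth ?size_tuple.
Qed.

Lemma basis_mx_free U : row_free (basis_mx U).
Proof.
apply: inj_row_free => x; rewrite mulmx_sum_row => x0.
have /freeP free_U := basis_free (vbasisP U).
apply/rowP => k; rewrite mxE; apply: (free_U (fun k => x 0 k)).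
by rewrite -[RHS]x0; apply: eq_bigr => l _; rewrite rowK.
Qed.

Lemma rowspace_basis_mx a (M : 'M[F]_(a, n)) U :
  (rowspace M <= U)%VS = (M <= basis_mx U)%MS.
Proof.
apply/span_subvP/row_subP => [sMU k | sMU _ /imageP[k _ ->]].
  by rewrite -mem_basis_mx; apply: sMU; apply: image_f.
by rewrite mem_basis_mx.
Qed.

End VspaceBasisMatrix.

Lemma trace_form_nondeg (F : finFieldType) a b (N : 'M[F]_(a, b)) :
  (forall M, \tr (M *m N^T) = 0) -> N = 0.
Proof.
move=> N0; apply/matrixP => k l; rewrite mxE -(N0 (delta_mx k l)).
rewrite /mxtrace (bigD1 k) //= big1 ?addr0 => [|j j_k].
  rewrite mxE (bigD1 l) //= big1 ?addr0 => [|t t_l]; rewrite !mxE ?eqxx ?mul1r //.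
  by rewrite (negPf t_l) andbF mul0r.
by rewrite mxE big1 // => t _; rewrite !mxE (negPf j_k) mul0r.
Qed.

Section TraceFunctionals.
Variables (F : finFieldType) (a b : nat) (W : {vspace 'M[F]_(a, b)}).

(** Its kernel is the orthogonal of [W] for the trace form. *)
Definition trace_row (N : 'M[F]_(a, b)) : 'rV[F]_(\dim W) :=
  \row_k \tr ((vbasis W)`_k *m N^T).

Lemma trace_row_is_linear : linear trace_row.
Proof.
move=> c x y; apply/rowP => k; rewrite !mxE linearP mulmxDr -scalemxAr.
by rewrite linearP.
Qed.

HB.instance Definition _ :=
  GRing.isLinear.Build F _ _ _ trace_row trace_row_is_linear.

(** If [trace_row] were injective, the full space would have dimension at most [\dim W]. *)
Lemma proper_trace_form :
  W != fullv -> exists2 N, N != 0 & forall M, M \in W -> \tr (M *m N^T) = 0.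
Proof.
move=> W_proper; pose K := lker (linfun trace_row).
have K0 : K != 0%VS.
  apply: contraNneq W_proper => K0; rewrite eqEdim subvf /=.
  rewrite -(limg_ker_dim (linfun trace_row) fullv) capfv -/K K0 dimv0 add0n.
  exact: dim_row_le.
exists (vpick K); first by rewrite vpick0.
move=> M /coord_vbasis->; have := memv_pick K.
rewrite memv_ker lfunE /= => /eqP/rowP trK.
rewrite mulmx_suml linear_sum big1 // => k _; rewrite -scalemxAl linearZ /=.
by have := trK k; rewrite !mxE => ->; rewrite mulr0.
Qed.

End TraceFunctionals.

Lemma bigminn_le (I : finType) (P : pred I) (f : I -> nat) d i :
  P i -> (\big[minn/d]_(i | P i) f i <= f i)%N.
Proof.
move=> Pi; have := mem_index_enum i; elim: (index_enum I) => // j r IH.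
rewrite inE big_cons => /predU1P[<-|/IH le_r]; first by rewrite Pi geq_minl.
by case: (P j) => //; rewrite geq_min le_r orbT.
Qed.

(** * Shortened codes and optimal anticodes *)

Section Shortening.
Variables (F : finFieldType) (n m : nat) (n_le_m : (n <= m)%N) (m_gt0 : (0 < m)%N).
(* [g] is the transposition for column spaces and, when [n = m], the identity
   for row spaces. *)
Variables (g : {linear 'M[F]_(n, m) -> 'M[F]_(m, n)}).
Variable g' : 'M[F]_(m, n) -> 'M[F]_(n, m).
Hypothesis g'K : cancel g' g.
Hypothesis rank_g : forall M, \rank (g M) = \rank M.
Hypothesis trace_g : forall M N, \tr (g M *m (g N)^T) = \tr (M *m N^T).
Implicit Types (C S : {vspace 'M[F]_(n, m)}) (U : {vspace 'rV[F]_n}).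

(** Right multiplication by this matrix kills exactly the rows in [U]. Taking a column basis leaves
    [n - \dim U] independent columns, so the target of [proj] has the dimension wanted in
    rank-nullity. *)
Let coker_mx U := col_base (cokermx (basis_mx F n U)).

Let proj U : 'Hom('M[F]_(n, m), 'M[F]_(m, \rank (cokermx (basis_mx F n U)))) :=
  linfun (mulmxr (coker_mx U) \o g).

Lemma rank_coker U : \rank (cokermx (basis_mx F n U)) = (n - \dim U)%N.
Proof. by rewrite mxrank_coker (eqP (basis_mx_free F n U)). Qed.

Lemma mem_lker_proj U M : (M \in lker (proj U)) = (rowspace (g M) <= U)%VS.
Proof.
rewrite memv_ker lfunE /= rowspace_basis_mx submxE.
by rewrite -[in RHS](mulmx_base (cokermx _)) mulmxA mulmx_free_eq0 ?row_base_free.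
Qed.

(** Rank-nullity, once [proj U] maps [C] onto its target. Otherwise a nonzero [N] is orthogonal to
    the image; its pullback [Z] is a dual element of rank at most [n - \dim U], hence 0, which
    forces [N] to be 0. *)
Lemma dim_cap_lker_proj C U :
  (forall N, N \in dual C -> (\rank N <= n - \dim U)%N -> N = 0) ->
  (\dim (C :&: lker (proj U)) + m * (n - \dim U))%N = \dim C.
Proof.
move=> dualC; rewrite -(limg_ker_dim (proj U) C); congr (_ + _)%N.
rewrite -rank_coker -(dim_fullv_matrix F); congr (\dim _); apply/esym/eqP.
apply/negPn/negP => /proper_trace_form[N N0 orthN]; case/negP: N0.
pose Z := g' (N *m (coker_mx U)^T).
have gZ : g Z = N *m (coker_mx U)^T by rewrite /Z g'K.
have Z0 : Z = 0.
  apply: dualC; last first.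
    by rewrite -rank_g gZ -rank_coker (leq_trans (mxrankM_maxl _ _)) ?rank_leq_col.
  rewrite inE; apply/forall_inP => M CM; apply/eqP.
  rewrite -trace_g gZ trmx_mul trmxK mulmxA.
  by have := orthN (proj U M) (memv_img _ CM); rewrite lfunE.
have : N *m (coker_mx U)^T = 0 by rewrite -gZ Z0 linear0.
move/eqP; rewrite mulmx_free_eq0 // /row_free mxrank_tr.
exact: col_base_full.
Qed.

Lemma dim_lker_proj U : \dim (lker (proj U)) = (m * \dim U)%N.
Proof.
have := dim_cap_lker_proj fullv U; rewrite capfv dim_fullv_matrix => dimK.
have {}dimK := dimK _; apply/eqP; rewrite -(eqn_add2r (m * (n - \dim U))) dimK.
  by rewrite -mulnDr subnKC ?dim_row_le // mulnC.
move=> N; rewrite inE => /forall_inP dualN _; apply: trace_form_nondeg => M.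
by apply/eqP/dualN; rewrite memvf.
Qed.

Lemma optimal_anticode_lker_proj U : optimal_anticode (lker (proj U)).
Proof.
rewrite /optimal_anticode dim_lker_proj eqn_mul2l; apply/orP; right.
rewrite eqn_leq; apply/andP; split.
  (* An element of maximal rank: as [\dim U <= n <= m], the [m] rows have room for a basis of
     [U]. *)
  pose M := g' (pid_mx (\dim U) *m basis_mx F n U).
  have gM : g M = pid_mx (\dim U) *m basis_mx F n U by rewrite /M g'K.
  have rkM : \rank M = \dim U.
    rewrite -rank_g gM mxrankMfree ?basis_mx_free // rank_pid_mx //.
    exact: leq_trans (dim_row_le _ _ U) n_le_m.
  rewrite -[X in (X <= _)%N]rkM; apply: leq_bigmax_cond.
  by rewrite mem_lker_proj rowspace_basis_mx gM submxMl.
apply/bigmax_leqP => M; rewrite mem_lker_proj rowspace_basis_mx => /mxrankS.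
by rewrite rank_g (eqP (basis_mx_free F n U)).
Qed.

(** By contraposition: the kernel of [proj U] is an optimal anticode of dimension [m * \dim U]
    meeting [C] in [S], so [i <= \dim S] would make it admissible in the minimum defining
    [gweight]. *)
Lemma dim_short_lt C U S i :
  (forall M, (M \in S) = (M \in C) && (rowspace (g M) <= U)%VS) ->
  (\dim U < gweight C i)%N -> (\dim S < i)%N.
Proof.
move=> memS; apply: contraTltn; rewrite -leqNgt => le_i.
rewrite /gweight -[leqRHS](mulKn _ m_gt0) -dim_lker_proj leq_div2r //.
apply: bigminn_le; rewrite optimal_anticode_lker_proj /=.
rewrite (leq_trans le_i) // dimvS //; apply/subvP => M.
by rewrite memS memv_cap mem_lker_proj andbC.
Qed.

(** A dual element of rank at most [n - \dim U] has rank below [ddual C], hence is zero. *)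
Lemma dim_short C U S :
  (forall M, (M \in S) = (M \in C) && (rowspace (g M) <= U)%VS) ->
  (n < \dim U + ddual C)%N -> (\dim S + m * (n - \dim U))%N = \dim C.
Proof.
move=> memS lt_n; rewrite -(dim_cap_lker_proj C U).
  congr (\dim _ + _)%N; apply/vspaceP => M.
  by rewrite memS memv_cap mem_lker_proj.
move=> N dualN rkN; apply/eqP; apply: contraTT lt_n => N0.
rewrite -leqNgt.
have le_rk : (ddual C <= \rank N)%N by apply: bigminn_le; rewrite dualN.
rewrite -[leqRHS](subnKC (dim_row_le F n U)) leq_add2l.
exact: leq_trans le_rk rkN.
Qed.

End Shortening.

Lemma gweight_le (F : finFieldType) n m (C : {vspace 'M[F]_(n, m)}) i :
  (0 < m)%N -> (gweight C i <= n)%N.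
Proof.
move=> m_gt0; rewrite -[leqRHS](mulnK _ m_gt0) leq_div2r //.
apply: (big_ind (fun d => (d <= n * m)%N)) => // [x y le_x _|A _].
  by rewrite geq_min le_x.
by rewrite -(dim_fullv_matrix F) dimvS ?subvf.
Qed.

(** * Binomial moments in the two extreme ranges *)

Section SideMoments.
Variables (F : finFieldType) (n m : nat) (n_le_m : (n <= m)%N) (m_gt0 : (0 < m)%N).
Variables (g : {linear 'M[F]_(n, m) -> 'M[F]_(m, n)}).
Variable g' : 'M[F]_(m, n) -> 'M[F]_(n, m).
Hypothesis g'K : cancel g' g.
Hypothesis rank_g : forall M, \rank (g M) = \rank M.
Hypothesis trace_g : forall M N, \tr (g M *m (g N)^T) = \tr (M *m N^T).
Variables (C : {vspace 'M[F]_(n, m)}).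
Variable S : {vspace 'rV[F]_n} -> {vspace 'M[F]_(n, m)}.
Hypothesis mem_S :
  forall U M, (M \in S U) = (M \in C) && (rowspace (g M) <= U)%VS.
Local Notation q := #|F|.

Lemma moment_low i u : (u < gweight C i)%N ->
  \sum_(U : {vspace 'rV[F]_n} | \dim U == u) gbinom q (\dim (S U)) i = 0.
Proof.
move=> lt_u; apply: big1 => U /eqP dimU; apply: gbinom_small.
by apply: (dim_short_lt _ _ _ n_le_m m_gt0 _ _ g'K rank_g trace_g _ _ _ _ (mem_S U));
  rewrite dimU.
Qed.

(** In this range all [S U] have the same dimension, and there are [gbinom q n u] choices of [U]. *)
Lemma moment_high (i u : nat) : (u <= n)%N -> (n < u + ddual C)%N ->
  \sum_(U : {vspace 'rV[F]_n} | \dim U == u) gbinom q (\dim (S U)) i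
  = gbinom q n u * gbinom q ((\dim C)%:Z - m%:Z * (n%:Z - u%:Z)) i.
Proof.
move=> le_un lt_n.
rewrite (eq_bigr (fun=> gbinom q ((\dim C)%:Z - m%:Z * (n%:Z - u%:Z)) i)).
  have := card_subspaces_between F 1 n 0%VS fullv u (sub0v _).
  rewrite dimv0 add0n subn0 dim_fullv_row => <-.
  rewrite sumr_const mulr_natl; congr (_ *+ _).
  by apply: eq_card => U; rewrite !inE sub0v subvf.
move=> U /eqP dimU; congr (gbinom _ _ _).
have lt_nU : (n < \dim U + ddual C)%N by rewrite dimU.
have := dim_short _ _ _ _ _ g'K rank_g trace_g _ _ _ (mem_S U) lt_nU.
by rewrite dimU => <-; rewrite PoszD PoszM -subzn // addrK.
Qed.

End SideMoments.

Section Moments.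
Variables (F : finFieldType) (n m : nat) (n_le_m : (n <= m)%N) (m_gt0 : (0 < m)%N).
Variables (C : {vspace 'M[F]_(n, m)}) (i : nat).
Local Notation q := #|F|.

Lemma colspace_tr (M : 'M[F]_(n, m)) : colspace M = rowspace M^T.
Proof. by congr (<<_>>%VS); apply: eq_map => j; rewrite tr_col. Qed.

Lemma mem_shortc_tr U M :
  (M \in shortc C U) = (M \in C) && (rowspace M^T <= U)%VS.
Proof. by rewrite mem_shortc colspace_tr. Qed.

Lemma mxtrace_tr_form (M N : 'M[F]_(n, m)) :
  \tr (M^T *m (N^T)^T) = \tr (M *m N^T).
Proof. by rewrite trmxK mxtrace_mulC -mxtrace_tr trmx_mul trmxK. Qed.

Lemma moment_low_col u : (u < gweight C i)%N ->
  \sum_(U : {vspace 'rV[F]_n} | \dim U == u) gbinom q (\dim (shortc C U)) i = 0.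
Proof.
exact: (moment_low _ _ _ n_le_m m_gt0 trmx trmx (@trmxK _ _ _)
  (@mxrank_tr _ _ _) mxtrace_tr_form _ _ mem_shortc_tr).
Qed.

Lemma moment_high_col u : (u <= n)%N -> (n < u + ddual C)%N ->
  \sum_(U : {vspace 'rV[F]_n} | \dim U == u) gbinom q (\dim (shortc C U)) i
  = gbinom q n u * gbinom q ((\dim C)%:Z - m%:Z * (n%:Z - u%:Z)) i.
Proof.
exact: (moment_high _ _ _ trmx trmx (@trmxK _ _ _)
  (@mxrank_tr _ _ _) mxtrace_tr_form _ _ mem_shortc_tr).
Qed.

End Moments.

Section SquareMoments.
Variables (F : finFieldType) (n : nat) (n_gt0 : (0 < n)%N).
Variables (C : {vspace 'M[F]_n}) (i : nat).
Local Notation q := #|F|.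

Lemma moment_low_row u : (u < gweight C i)%N ->
  \sum_(U : {vspace 'rV[F]_n} | \dim U == u) gbinom q (\dim (shortr C U)) i = 0.
Proof.
exact: (moment_low _ _ _ (leqnn n) n_gt0 idfun id (fun=> erefl)
  (fun=> erefl) (fun _ _ => erefl) _ _ (mem_shortr C)).
Qed.

Lemma moment_high_row u : (u <= n)%N -> (n < u + ddual C)%N ->
  \sum_(U : {vspace 'rV[F]_n} | \dim U == u) gbinom q (\dim (shortr C U)) i
  = gbinom q n u * gbinom q ((\dim C)%:Z - n%:Z * (n%:Z - u%:Z)) i.
Proof.
exact: (moment_high _ _ _ idfun id (fun=> erefl)
  (fun=> erefl) (fun _ _ => erefl) _ _ (mem_shortr C)).
Qed.

End SquareMoments.

(** * Bernstein expansion of the weight enumerator *)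

Section BinomialMoments.
Variables (F : finFieldType) (n m : nat) (n_le_m : (n <= m)%N) (m_gt0 : (0 < m)%N).
Variables (C : {vspace 'M[F]_(n, m)}) (i : nat).
Local Notation q := #|F|.

Lemma binmoment_low u : (u < gweight C i)%N -> binmoment C i u = 0.
Proof.
move=> lt_u; rewrite /binmoment moment_low_col //; case: ltnP => // le_mn.
have eq_nm : n = m by apply/eqP; rewrite eqn_leq n_le_m.
by subst m; rewrite moment_low_row // addr0 mulr0.
Qed.

Lemma binmoment_high u : (u <= n)%N -> (n < u + ddual C)%N ->
  binmoment C i u
  = gbinom q n u * gbinom q ((\dim C)%:Z - m%:Z * (n%:Z - u%:Z)) i.
Proof.
move=> le_un lt_n; rewrite /binmoment moment_high_col //; case: ltnP => // le_mn.
have eq_nm : n = m by apply/eqP; rewrite eqn_leq n_le_m.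
by subst m; rewrite moment_high_row //; field.
Qed.

(** Up to the threshold this is the definition of [nbinmoment]; above it,
    [n < u + gweight C i + ddual C] and [binmoment_high] yields the closed form used there. *)
Lemma binmoment_normalized u : (u + gweight C i <= n)%N ->
  binmoment C i (u + gweight C i) =
  nbinmoment C i u * gbinom q n (u + gweight C i)%N.
Proof.
move=> le_un; rewrite /nbinmoment /=.
have [_|lt_u] := lerP u%:Z _.
  by rewrite -PoszD divfK // gbinom_neq0 ?finNzRing_gt1.
rewrite binmoment_high //; last by lia.
by rewrite mulrC PoszD opprD addrA.
Qed.

Lemma wtenum_binmoment : wtenum C i = \sum_(u < n.+1) binmoment C i u *:
  ('X_1 ^+ u * \prod_(j < n - u) ('X_0 - (q ^ j)%:R *: 'X_1)).
Proof.
have colE := support_enumerator F n m n (@colspace F n m) C (shortc C) (mem_shortc C)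
  {mpoly rat[2]} 'X_0 'X_1 i.
rewrite /wtenum /wtdistr /binmoment; case: ltnP => [_|le_mn]; first exact: colE.
have eq_nm : n = m by apply/eqP; rewrite eqn_leq n_le_m.
subst m; have rowE := support_enumerator F n n n (@rowspace F n n) C (shortr C)
  (mem_shortr C) {mpoly rat[2]} 'X_0 'X_1 i.
under eq_bigr do rewrite -scalerA scalerDl.
rewrite -scaler_sumr big_split /= [X in X + _]colE [X in _ + X]rowE -big_split /=.
by rewrite scaler_sumr; apply: eq_bigr => u _; rewrite -scalerDl scalerA.
Qed.

(** The shift comes from [binmoment_low], which removes the indices below [gweight C i]. *)
Lemma wtenum_bernstein : wtenum C i =
  \sum_(v < (n - gweight C i).+1)
     nbinmoment C i v *: qbernstein q n (v + gweight C i).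
Proof.
have le_dn := gweight_le F n m C i m_gt0.
rewrite wtenum_binmoment -(big_mkord xpredT (fun u => binmoment C i u *:
  ('X_1 ^+ u * \prod_(j < n - u) ('X_0 - (q ^ j)%:R *: 'X_1)))).
rewrite (big_cat_nat (leq0n _) (leqW le_dn)) /= big_nat big1 ?add0r; last first.
  by move=> u /andP[_ lt_u]; rewrite binmoment_low ?scale0r.
rewrite -{1}[gweight C i]add0n big_addn subSn // big_mkord.
apply: eq_bigr => v _; rewrite /qbernstein scalerA -binmoment_normalized //.
by rewrite addnC -leq_subRL -1?ltnS.
Qed.

End BinomialMoments.

(** * Zeta coefficients as convolutions *)

(** The coefficient of X^j in the product of the 1 - q^(ms) X for s from 0 to i. *)
Definition zweight (q m i j : nat) : rat :=
  gbinom (q ^ m) i.+1 j * (-1) ^+ j * (q ^ (m * 'C(j, 2)))%:R.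

Lemma zweight0 q m i : zweight q m i 0 = 1.
Proof. by rewrite /zweight gbinom0r bin0n muln0 !mulr1. Qed.

(** Terms with j > i+1 vanish with the binomial and terms with j > u with [h], so both sums extend
    to a common range. *)
Lemma conv_zweight q m i (h : int -> rat) u : (forall z, z < 0 -> h z = 0) ->
  \sum_(j < i.+2) zweight q m i j * h (u%:Z - j%:Z)
  = conv (zweight q m i) (fun l : nat => h l) u.
Proof.
move=> h_neg; pose f j := zweight q m i j * h (u%:Z - j%:Z).
have widen k : (k <= (i + u).+2)%N ->
    (forall j, (k <= j)%N -> f j = 0) ->
    \sum_(j < k) f j = \sum_(j < (i + u).+2) f j.
  move=> le_k f0; rewrite (big_ord_widen _ f le_k) big_mkcond.
  by apply: eq_bigr => j _; case: ltnP => // /f0.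
transitivity (\sum_(j < u.+1) f j).
  rewrite [RHS]widen; last 2 first.
  - by rewrite ltnS ltnW // ltnS leq_addl.
  - by move=> j lt_uj; rewrite /f h_neg ?mulr0 // subr_lt0 ltz_nat.
  apply: widen => [|j lt_ij]; first by rewrite !ltnS leq_addr.
  by rewrite /f /zweight gbinom_small // !mul0r.
by apply: eq_bigr => j _; rewrite /f subzn // -ltnS.
Qed.

Lemma zcoef_conv (F : finFieldType) n m (C : {vspace 'M[F]_(n, m)}) i u :
  zcoef C i u =
  conv (zweight #|F| m i) (fun l : nat => nbinmoment C i l) u.
Proof. by apply: conv_zweight => z z_lt0; rewrite /nbinmoment z_lt0. Qed.

Lemma zcoef_tau_conv q m i tau u :
  zcoef_tau q m i tau u =
  conv (zweight q m i) (fun l : nat => nbinmoment_tau q m i tau l) u.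
Proof. by apply: conv_zweight => z z_lt0; rewrite /nbinmoment_tau z_lt0. Qed.

Lemma zcoef_tau0_neq0 q m i tau : (1 < q)%N -> (0 < m)%N ->
  zcoef_tau q m i tau 0 != 0.
Proof.
move=> q_gt1 m_gt0; rewrite zcoef_tau_conv /conv big_ord_recl big_ord0 addr0.
rewrite zweight0 mul1r /nbinmoment_tau /= sub0r.
(* The upper argument of the binomial: [m] times the floor is at most [tau - i], so [a] is at least
   [i]. *)
set a := (tau%:Z + _)%R.
have le_ia : i%:Z <= a.
  have := lez_floor (tau%:Z - i%:Z) (_ : m%:Z != 0); rewrite /a mulrN.
  by move/(_ (lt0r_neq0 _)); lia.
by case: a le_ia => // a; rewrite lez_nat => le_ia; apply: gbinom_neq0.
Qed.

Lemma conv_beta (F : finFieldType) n m (C : {vspace 'M[F]_(n, m)}) i tau v :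
  (0 < m)%N ->
  conv (beta C i tau) (fun l : nat => nbinmoment_tau #|F| m i tau l) v
  = nbinmoment C i v.
Proof.
move=> m_gt0; set nbt := fun l => _; pose nb (l : nat) := nbinmoment C i l.
pose G := zweight #|F| m i; pose pt := zcoef_tau #|F| m i tau.
have pt0 : pt 0%N != 0 by apply: zcoef_tau0_neq0; rewrite ?finNzRing_gt1.
(* The inverse of [pt] for convolution, by [conv_bell]. *)
pose r l :=
  bell l (fun j => if j == 0%N then pt 0%N else - pt j) / pt 0%N ^+ (l + 1).
have betaE l : beta C i tau l = conv (zcoef C i) r l.
  by apply: eq_bigr => j _; rewrite /r -mulrA [X in _ * X]mulrC.
(* It suffices to compare after convolution with [G], which turns [nbt] into [pt] and [nb] into
   [zcoef C i]. *)
apply: (conv_inj _ G (conv (beta C i tau) nbt) nb _ _ v) => [|{}v].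
  exact: zweight0.
rewrite -[RHS]zcoef_conv -[RHS]conv1.
transitivity (conv (beta C i tau) pt v).
  rewrite [LHS]convA; transitivity (conv (conv (beta C i tau) G) nbt v).
    by apply: eq_conv => // j _; rewrite convC.
  by rewrite -convA; apply: eq_conv => // j _; rewrite /pt zcoef_tau_conv.
transitivity (conv (conv (zcoef C i) r) pt v); first by apply: eq_conv.
by rewrite -convA; apply: eq_conv => // j _; apply: conv_bell.
Qed.

Theorem corollary6p9 (F : finFieldType) (n m : nat)
    (n_ge2 : (2 <= n)%N) (n_le_m : (n <= m)%N)
    (C : {vspace 'M[F]_(n, m)}) (i : nat) (i_le_k : (i <= \dim C)%N)
    (tau : nat) (tau_le : (tau <= m - 1)%N) :
  wtenum C i =
  \sum_(j < (n - gweight C i).+1)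
     beta C i tau j *: mrdenum #|F| n m i tau (gweight C i + j).
Proof.
have m_gt0 : (0 < m)%N by apply: leq_trans n_le_m; apply: ltnW.
pose d := gweight C i.
(* The contribution of the j-th beta to the Bernstein term of index [v + d]. *)
pose f j v := (beta C i tau j * nbinmoment_tau #|F| m i tau (v - j)%N)
  *: qbernstein #|F| n (v + d).
transitivity (\sum_(v < (n - d).+1) \sum_(j < v.+1) f j v).
  rewrite wtenum_bernstein //; apply: eq_bigr => v _.
  by rewrite -scaler_suml -(conv_beta _ _ _ _ _ tau).
(* With v = u + j, the index u runs up to [n - (d + j)], the range in [mrdenum]. *)
rewrite -triangular_sum; apply: eq_bigr => j _.
rewrite /mrdenum scaler_sumr subnDA; apply: eq_bigr => u _.
by rewrite scalerA /f addnK -addnA [(j + d)%N]addnC.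
Qed.
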